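(* For every tree $T$, $\phi'_3(T) \leq 4\,\mathrm{pw}(T)$.
   Context: Graphs are finite, simple and undirected. $\mathrm{pw}(T)$ denotes the pathwidth of $T$: the minimum over all path decompositions of $T$ of the maximum bag size minus one, where a path decomposition of $T$ is a sequence $B_1,\dots,B_s$ of subsets (bags) of $V(T)$ such that every vertex lies in some bag, both endpoints of every edge lie together in some bag, and for each vertex the indices of the bags containing it form an interval. A $3$-anagram is a word $W_1W_2W_3$ where each $W_i$ is a permutation of one common non-empty word $W$ (i.e. each symbol occurs equally often in $W_1$, $W_2$ and $W_3$). An edge colouring of a graph $G$ is a function from $E(G)$ to a set of colours (no properness is assumed). An edge colouring of $G$ is $3$-anagram-free if for every path that is a subgraph of $G$, the sequence of colours of the edges along the path is not a $3$-anagram. The $3$-anagram-free chromatic index $\phi'_3(G)$ is the minimum number of colours in a $3$-anagram-free edge colouring of $G$ (so it is $0$ if $G$ has no edges). *)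

(* Defs.v *)
From mathcomp Require Import all_boot boolp.

Set Implicit Arguments.
Unset Strict Implicit.
Unset Printing Implicit Defensive.

Record sgraph := SGraph {
  vertex :> finType;
  adj : rel vertex;
  adj_sym : symmetric adj;
  adj_irrefl : irreflexive adj
}.
Arguments adj {s}.

Definition edges (G : sgraph) : {set {set G}} :=
  [set A | [exists x : G, exists y : G, adj x y && (A == [set x; y])]].

Definition edge (G : sgraph) : finType := {A : {set G} | A \in edges G}.

Definition connected_graph (G : sgraph) : Prop :=
  0 < #|G| /\ forall x y : G, connect adj x y.

Definition acyclic_graph (G : sgraph) : Prop :=
  forall s : seq G, 3 <= size s -> ~ ucycle adj s.

Definition is_tree (G : sgraph) : Prop := connected_graph G /\ acyclic_graph G.

(* [x :: p] is the vertex sequence of a path that is a subgraph of [G]. *)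
Definition is_path (G : sgraph) (x : G) (p : seq G) : bool :=
  path adj x p && uniq (x :: p).

(* [pmap insub] only equips each pair of consecutive vertices with the proof
   that it is an edge; it discards nothing along a walk, see [val_path_edges]. *)
Definition path_edges (G : sgraph) (x : G) (p : seq G) : seq (edge G) :=
  pmap insub (pairmap (fun y z => [set y; z]) x p).

Definition anagram3 (C : eqType) (s : seq C) : Prop :=
  exists w w1 w2 w3 : seq C,
    [/\ w != [::], s = w1 ++ w2 ++ w3,
        perm_eq w1 w, perm_eq w2 w & perm_eq w3 w].

Definition anagram3_free (G : sgraph) (C : eqType) (c : edge G -> C) : Prop :=
  forall (x : G) (p : seq G),
    is_path x p -> ~ anagram3 [seq c a | a <- path_edges x p].

Definition anagram3_colourable (G : sgraph) (k : nat) : Prop :=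
  exists c : edge G -> 'I_k, anagram3_free c.

Lemma val_path_edges (G : sgraph) (x : G) (p : seq G) :
  path adj x p ->
  map val (path_edges x p) = pairmap (fun y z => [set y; z]) x p.
Proof.
rewrite /path_edges; elim: p x => //= y p IHp x /andP[xy yp].
have xyE : [set x; y] \in edges G.
  by rewrite inE; apply/existsP; exists x; apply/existsP; exists y; rewrite xy eqxx.
by rewrite insubT /= IHp.
Qed.

Lemma path_edges_uniq (G : sgraph) (x : G) (p : seq G) :
  uniq (x :: p) -> uniq (path_edges x p).
Proof.
move=> up; apply: pmap_sub_uniq.
elim: p x up => //= y p IHp x /andP[xNp up].
rewrite IHp // andbT; apply/negP => xyp.
suff [A Ay xA] : exists2 A : {set G}, A \in pairmap (fun y z => [set y; z]) y p & x \in A.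
  have sub (z : G) q B : B \in pairmap (fun y z => [set y; z]) z q ->
      {subset B <= z :: q}.
    elim: q z => //= t q IHq z; rewrite inE => /predU1P[-> u|/IHq Bq u /Bq].
      by rewrite !inE => /orP[]->; rewrite ?orbT.
    by rewrite [in X in _ -> X]inE => ->; rewrite orbT.
  by case/negP: xNp; apply: sub Ay _ xA.
by exists [set x; y]; rewrite // !inE eqxx.
Qed.

Lemma anagram3_colourable_ex (G : sgraph) :
  exists k, `[< anagram3_colourable G k >].
Proof.
exists #|edge G|; apply/asboolP; exists enum_rank => x p /andP[_ up].
case=> w [w1 [w2 [w3 [w0 def_s w1w w2w _]]]].
have: uniq (map enum_rank (path_edges x p)).
  by rewrite (map_inj_uniq enum_rank_inj) path_edges_uniq.
case: w w0 w1w w2w => // a w _ w1w w2w.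
rewrite def_s cat_uniq => /and3P[_ /hasPn/(_ a)].
by rewrite mem_cat (perm_mem w2w) /= (perm_mem w1w) mem_head => /(_ isT).
Qed.

Definition anagram3_index (G : sgraph) : nat :=
  ex_minn (anagram3_colourable_ex G).

Definition path_decomposition (G : sgraph) (B : seq {set G}) : Prop :=
  [/\ forall x : G, exists2 b, b \in B & x \in b,
      forall x y : G, adj x y -> exists2 b, b \in B & (x \in b) && (y \in b)
    & forall (x : G) (i j k : nat), i <= j <= k -> k < size B ->
        x \in nth set0 B i -> x \in nth set0 B k -> x \in nth set0 B j].

(* Truncated predecessor: it agrees with the integer one as soon as some bag is
   non-empty, which holds for every decomposition of a non-empty graph. *)
Definition width (G : sgraph) (B : seq {set G}) : nat :=
  (\max_(b <- B) #|b|).-1.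

Definition has_width (G : sgraph) (k : nat) : Prop :=
  exists2 B : seq {set G}, path_decomposition B & width B = k.

Lemma has_width_ex (G : sgraph) : exists k, `[< has_width G k >].
Proof.
exists (width [:: [set: G]]); apply/asboolP; exists [:: setT] => //; split.
- by move=> x; exists setT; rewrite ?inE.
- by move=> x y _; exists setT; rewrite ?inE.
by move=> x i j [|//] /andP[_]; rewrite leqn0 => /eqP->.
Qed.

Definition pathwidth (G : sgraph) : nat := ex_minn (has_width_ex G).

(* Main.v *)
Require Import Defs.
From mathcomp Require Import all_boot.
From mathcomp Require Import zify.

(** A tree of pathwidth [k + 1] has a path meeting every bag of an optimal path
    decomposition: any path from a vertex of the leftmost non-empty bag to a
    vertex of the rightmost one.  Deleting that path, the spine, lowers the
    pathwidth, but leaves a forest; so the induction is on forests, with one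
    spine in each component ([spine_exists]), and four colours are spent per
    layer of spines ([colouring_exists]).

    Three of the four colours are used on the edges of the spines, which are
    coloured along each spine by a ternary word without abelian cubes, that is,
    without factor that is a 3-anagram.  The fourth one is used on the edges
    between a spine and a vertex off it.  Since paths in a forest are unique
    ([acyclic_path_unique]), a path meets a spine in a sub-path of it and then
    has at most two edges of the fourth colour ([crossings_le2]).  In a 3-anagram
    every colour occurs a multiple of three times, so a path coloured by a
    3-anagram has no such edge: it lies inside a spine, where the word forbids
    it, or off the spines, where the induction hypothesis does
    ([extend_colouring]).

    The words come from Dekking's morphism a -> aabc, b -> bbc, c -> acc, which
    preserves the absence of abelian cubes ([dekking_abelian_cube_free]).  With
    the weights a = 4, b = 1, c = 5 modulo 7 every block has weight 0, and the
    prefixes of an image have weights in {0, 1, 2, 4}, a set without non-constant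
    4-term arithmetic progression.  So the four cuts bounding an abelian cube
    have the same weight, which allows moving them together to block boundaries
    and desubstituting. *)

Set Implicit Arguments.
Unset Strict Implicit.
Unset Printing Implicit Defensive.

(** * 3-anagrams *)

Lemma anagram3_map (C D : eqType) (h : C -> D) (s : seq C) :
  anagram3 s -> anagram3 (map h s).
Proof.
case=> w [w1 [w2 [w3 [w0 -> e1 e2 e3]]]].
exists (map h w), (map h w1), (map h w2), (map h w3).
by rewrite !map_cat !perm_map //; split=> //; case: w w0 {e1 e2 e3}.
Qed.

Lemma anagram3_rev (C : eqType) (s : seq C) : anagram3 s -> anagram3 (rev s).
Proof.
case=> w [w1 [w2 [w3 [w0 -> e1 e2 e3]]]].
by exists w, (rev w3), (rev w2), (rev w1); rewrite !rev_cat catA !perm_rev.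
Qed.

Lemma anagram3_count (C : eqType) (a : pred C) (s : seq C) :
  anagram3 s -> 3 %| count a s.
Proof.
case=> w [w1 [w2 [w3 [w0 -> /permP e1 /permP e2 /permP e3]]]].
by rewrite !count_cat e1 e2 e3; lia.
Qed.

Lemma anagram3_nil (C : eqType) : ~ anagram3 ([::] : seq C).
Proof.
case=> w [w1 [w2 [w3 [w0 e e1 _ _]]]].
move: (perm_size e1) w0; rewrite -size_eq0 => <-.
by case: w1 e {e1}.
Qed.

(** * Arbitrarily long ternary words without abelian cubes *)

Definition abelian_cube_free (C : eqType) (w : seq C) : Prop :=
  forall s, infix s w -> ~ anagram3 s.

(** Dekking's morphism a -> aabc, b -> bbc, c -> acc, with a = 0, b = 1 and
    c = 2.  The last clause is meant for the letter 2 only; [ternary] keeps the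
    other values away. *)
Definition dekking_block (l : nat) : seq nat :=
  match l with 0 => [:: 0; 0; 1; 2] | 1 => [:: 1; 1; 2] | _ => [:: 0; 2; 2] end.

Definition dekking (w : seq nat) : seq nat := flatten (map dekking_block w).

Definition ternary (w : seq nat) : bool := all (fun l => l < 3) w.

Lemma dekking_ternary w : ternary (dekking w).
Proof.
elim: w => //= l w IH; rewrite /ternary /dekking /= all_cat.
by apply/andP; split=> //; case: l => [|[|l]].
Qed.

Lemma size_ternary w : ternary w ->
  size w = count_mem 0 w + count_mem 1 w + count_mem 2 w.
Proof.
elim: w => [|l w IH] //= /andP[l3 /IH->].
by case: l l3 => [|[|[|]]] //= _; lia.
Qed.

(** The incidence matrix of the morphism is invertible, so letter counts of an
    image determine those of the word: this is what makes desubstitution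
    possible in [dekking_abelian_cube_free]. *)
Lemma count_dekking w : ternary w ->
  [/\ count_mem 0 (dekking w) = 2 * count_mem 0 w + count_mem 2 w,
      count_mem 1 (dekking w) = count_mem 0 w + 2 * count_mem 1 w &
      count_mem 2 (dekking w) =
        count_mem 0 w + count_mem 1 w + 2 * count_mem 2 w].
Proof.
elim: w => [|l w IH] //= /andP[l3 /IH[IH0 IH1 IH2]].
rewrite /dekking /= -/(dekking w) !count_cat IH0 IH1 IH2.
by case: l l3 => [|[|[|//]]] _ /=; split; lia.
Qed.

Lemma size_dekking w : 3 * size w <= size (dekking w).
Proof.
elim: w => // l w IH; rewrite /dekking /= -/(dekking w) size_cat.
by case: l => [|[|l]] /=; lia.
Qed.

(** Wherever an image is cut, a whole block boundary is reached by one of four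
    moves: none, dropping an initial a, completing by bc, or completing by c.
    The blocks aabc, bbc and acc are designed so that the letters crossed do not
    depend on the block being cut, only on the weight of the prefix modulo 7. *)
Lemma dekking_cut w x y : ternary w -> x ++ y = dekking w ->
  exists2 v, prefix v w &
    [\/ x = dekking v, rcons (dekking v) 0 = x,
        x ++ [:: 1; 2] = dekking v | rcons x 2 = dekking v].
Proof.
elim: w x => [|l w IH] x /=.
  by case: x => // _ _; exists [::] => //; constructor 1.
case/andP=> l3 w3; rewrite /dekking /= -/(dekking w).
have later z : z ++ y = dekking w ->
  exists2 v, prefix v (l :: w) &
    [\/ dekking_block l ++ z = dekking v,
        rcons (dekking v) 0 = dekking_block l ++ z,
        (dekking_block l ++ z) ++ [:: 1; 2] = dekking v
      | rcons (dekking_block l ++ z) 2 = dekking v].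
  move=> /(IH _ w3)[v vw H]; exists (l :: v); first by rewrite /= eqxx.
  rewrite /dekking /= -/(dekking v) !rcons_cat -catA.
  by case: H => ->; [constructor 1|constructor 2|constructor 3|constructor 4].
have ex0 : prefix [::] (l :: w) by [].
have ex1 : prefix [:: l] (l :: w) by rewrite /= eqxx prefix0s.
case: l l3 later ex0 ex1 => [|[|[|//]]] _ /= later ex0 ex1.
- case: x => [|x0 [|x1 [|x2 [|x3 x]]]] /=.
  + by exists [::] => //; constructor 1.
  + by case=> -> _; exists [::] => //; constructor 2.
  + by case=> -> -> _; exists [:: 0] => //; constructor 3.
  + by case=> -> -> -> _; exists [:: 0] => //; constructor 4.
  + by case=> -> -> -> -> /later.
- case: x => [|x0 [|x1 [|x2 x]]] /=.
  + by exists [::] => //; constructor 1.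
  + by case=> -> _; exists [:: 1] => //; constructor 3.
  + by case=> -> -> _; exists [:: 1] => //; constructor 4.
  + by case=> -> -> -> /later.
- case: x => [|x0 [|x1 [|x2 x]]] /=.
  + by exists [::] => //; constructor 1.
  + by case=> -> _; exists [::] => //; constructor 2.
  + by case=> -> -> _; exists [:: 2] => //; constructor 4.
  + by case=> -> -> -> /later.
Qed.

(** Modulo 7 this is the additive weight a = 4, b = 1, c = 5 for which all three
    blocks have weight 0, so the weight of a prefix of an image only depends on
    where the prefix cuts its last block. *)
Definition weight (x : seq nat) : nat :=
  4 * count_mem 0 x + count_mem 1 x + 5 * count_mem 2 x.

(** The weight of a prefix modulo 7 tells which of the four moves of [dekking_cut]
    leads to a block boundary: 0 for none, 4 for the dropped a, 1 for bc, 2 for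
    c.  Hence two cuts with the same residue [t] differ from block boundaries by the
    same letters, whatever the blocks. *)
Lemma dekking_cut_count w x y : ternary w -> x ++ y = dekking w ->
  exists2 v, prefix v w & exists2 t, t \in [:: 0; 4; 1; 2] &
    [/\ weight x %% 7 = t,
        count_mem 0 (dekking v) + (t == 4) = count_mem 0 x,
        count_mem 1 (dekking v) = count_mem 1 x + (t == 1) &
        count_mem 2 (dekking v) = count_mem 2 x + (t \in [:: 1; 2])].
Proof.
move=> w3 /(dekking_cut w3)[v vw H]; exists v => //.
have v3 : ternary v.
  by case/prefixP: vw w3 => u ->; rewrite /ternary all_cat => /andP[].
have [] := count_dekking v3; rewrite /weight.
by case: H => [->|<-|<-|<-]; rewrite -?cats1 ?count_cat /= => e0 e1 e2;
  [exists 0 | exists 4 | exists 1 | exists 2] => //; split=> /=; lia.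
Qed.

(** A finite check on the four residues that cuts can have: this is what selects
    the modulus 7 and keeps the cuts around an abelian cube aligned. *)
Lemma no_4AP_mod7 a b c d :
  a \in [:: 0; 4; 1; 2] -> b \in [:: 0; 4; 1; 2] ->
  c \in [:: 0; 4; 1; 2] -> d \in [:: 0; 4; 1; 2] ->
  a + c = 2 * b %[mod 7] -> b + d = 2 * c %[mod 7] ->
  [/\ b = a, c = a & d = a].
Proof.
rewrite !inE.
by move=> /or4P[]/eqP-> /or4P[]/eqP-> /or4P[]/eqP-> /or4P[]/eqP->.
Qed.

Lemma prefix_total (C : eqType) (v v' w : seq C) : prefix v w -> prefix v' w ->
  (exists u, v' = v ++ u) \/ (exists u, v = v' ++ u).
Proof.
wlog le : v v' / size v <= size v'.
  move=> H pv pv'; case: (leqP (size v) (size v')) => [|/ltnW] le.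
    exact: H.
  by case: (H _ _ le pv' pv); [right|left].
move=> /prefixP[y ->] /prefixP[y' e]; left; exists (drop (size v) v').
have : take (size v) (v ++ y) = take (size v) (v' ++ y') by rewrite e.
by rewrite take_size_cat // takel_cat // => {1}->; rewrite cat_take_drop.
Qed.

Lemma perm_ternary u u' : ternary u -> ternary u' ->
  count_mem 0 u = count_mem 0 u' -> count_mem 1 u = count_mem 1 u' ->
  count_mem 2 u = count_mem 2 u' -> perm_eq u u'.
Proof.
move=> u3 u3' e0 e1 e2; apply/allP => c; rewrite mem_cat /=.
move=> H; have {H}: c < 3 by case/orP: H => [/(allP u3)|/(allP u3')].
by case: c => [|[|[|//]]] _; apply/eqP.
Qed.

(** The four cuts that bound an abelian cube in an image have residues in
    arithmetic progression, hence equal by [no_4AP_mod7].  Moving all of them to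
    block boundaries exchanges the same letters at both ends of each third, so
    the cube becomes the image of three words; these form an abelian cube since
    the incidence matrix is invertible. *)
Lemma dekking_abelian_cube_free w :
  ternary w -> abelian_cube_free w -> abelian_cube_free (dekking w).
Proof.
move=> tw free s /infixP[p [q eq_w]] [W [w1 [w2 [w3 [W0 es]]]]].
move=> /permP e1 /permP e2 /permP e3.
have h0 := dekking_cut_count (x := p) (y := s ++ q) tw (esym eq_w).
have h1 := dekking_cut_count (x := p ++ w1) (y := w2 ++ w3 ++ q) tw.
have h2 := dekking_cut_count (x := p ++ w1 ++ w2) (y := w3 ++ q) tw.
have h3 := dekking_cut_count (x := p ++ w1 ++ w2 ++ w3) (y := q) tw.
rewrite eq_w es -!catA in h1 h2 h3.
have {h0} [v0 v0w [t0 i0 [T0 a0 b0 c0]]] := h0.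
have {h1} [v1 v1w [t1 i1 [T1 a1 b1 c1]]] := h1 erefl.
have {h2} [v2 v2w [t2 i2 [T2 a2 b2 c2]]] := h2 erefl.
have {h3} [v3 v3w [t3 i3 [T3 a3 b3 c3]]] := h3 erefl.
rewrite /weight !count_cat ?e1 ?e2 ?e3 in T1 T2 T3 a1 a2 a3 b1 b2 b3 c1 c2 c3.
(* The weights of the cuts increase by the weight of [W] at each step. *)
have [] := no_4AP_mod7 i0 i1 i2 i3.
- by rewrite -T0 -T1 -T2 modnDm modnMmr /weight; congr (_ %% _); clear; lia.
- by rewrite -T1 -T2 -T3 modnDm modnMmr; congr (_ %% _); clear; lia.
move=> E1 E2 E3; rewrite {}E1 in a1 b1 c1; rewrite {}E2 in a2 b2 c2.
rewrite {}E3 in a3 b3 c3.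
have tern v : prefix v w -> ternary v.
  by case/prefixP=> u ew; move: tw; rewrite ew /ternary all_cat => /andP[].
have [A0 B0 C0] := count_dekking (tern _ v0w).
have [A1 B1 C1] := count_dekking (tern _ v1w).
have [A2 B2 C2] := count_dekking (tern _ v2w).
have [A3 B3 C3] := count_dekking (tern _ v3w).
rewrite {}A0 {}B0 {}C0 in a0 b0 c0; rewrite {}A1 {}B1 {}C1 in a1 b1 c1.
rewrite {}A2 {}B2 {}C2 in a2 b2 c2; rewrite {}A3 {}B3 {}C3 in a3 b3 c3.
have {}W0 : 0 < count_mem 0 W + count_mem 1 W + count_mem 2 W.
  rewrite -size_ternary; first by rewrite lt0n size_eq0.
  apply/allP => c; rewrite -has_pred1 has_count -e1 -has_count has_pred1 => cw1.
  apply: (allP (dekking_ternary w)); rewrite eq_w es !mem_cat cw1 orbT //.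
(* With equal residues the corrections at the four cuts are the same unknowns. *)
move: (_ == 4) (_ == 1) (_ \in _) a0 a1 a2 a3 b0 b1 b2 b3 c0 c1 c2 c3 =>
  r4 r1 r12 a0 a1 a2 a3 b0 b1 b2 b3 c0 c1 c2 c3.
(* The image of [v1] has more letters than that of [v0], so [v1] is not a prefix
   of [v0]; likewise for the other cuts. *)
have [[u1 eu1]|[u1 eu1]] := prefix_total v0w v1w; last first.
  by exfalso; move: W0 a0 a1 b0 b1 c0 c1; rewrite eu1 !count_cat; clear; lia.
have [[u2 eu2]|[u2 eu2]] := prefix_total v1w v2w; last first.
  by exfalso; move: W0 a1 a2 b1 b2 c1 c2; rewrite eu2 !count_cat; clear; lia.
have [[u3 eu3]|[u3 eu3]] := prefix_total v2w v3w; last first.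
  by exfalso; move: W0 a2 a3 b2 b3 c2 c3; rewrite eu3 !count_cat; clear; lia.
have := tern _ v3w; rewrite eu3 eu2 eu1 /ternary !all_cat -!andbA.
case/and4P=> _ u1t u2t u3t.
rewrite eu3 eu2 eu1 !count_cat in a3 b3 c3.
rewrite eu2 eu1 !count_cat in a2 b2 c2; rewrite eu1 !count_cat in a1 b1 c1.
apply: (free (u1 ++ u2 ++ u3)).
  case/prefixP: v3w => y ->; rewrite eu3 eu2 eu1 -!catA.
  by apply/infixP; exists v0, y; rewrite -!catA.
exists u1, u1, u2, u3; split => //.
- apply/eqP => u10; move: W0 a0 a1 b0 b1 c0 c1.
  by rewrite u10; clear; rewrite /=; lia.
- by apply: perm_ternary => //; move: a0 a1 a2 b0 b1 b2 c0 c1 c2; clear; lia.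
- apply: perm_ternary => //.
  + by move: a0 a1 a2 a3 b0 b1 b2 b3 c0 c1 c2 c3; clear; lia.
  + by move: a0 a1 a2 a3 b0 b1 b2 b3 c0 c1 c2 c3; clear; lia.
  + by move: a0 a1 a2 a3 b0 b1 b2 b3 c0 c1 c2 c3; clear; lia.
Qed.

Lemma ternary_cube_free_word n :
  exists2 w, n < size w & ternary w /\ abelian_cube_free w.
Proof.
elim: n => [|n [w sw [w3 free]]].
  exists [:: 0] => //; split=> // s /size_infix /= s1 s3.
  have := anagram3_count predT s3; rewrite count_predT.
  by case: s s1 s3 => [_ /anagram3_nil|? []].
exists (dekking w); last first.
  by split; [exact: dekking_ternary | exact: dekking_abelian_cube_free].
by have := size_dekking w; lia.
Qed.

(** * Paths in acyclic graphs *)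

(** At the first place where two such paths part, the second one followed by the
    reverse of the first one joins the two next vertices while avoiding the
    current one; shortened to a simple path, it closes up into a cycle. *)
Lemma acyclic_path_unique (G : sgraph) (x : G) (p q : seq G) :
  acyclic_graph G -> path adj x p -> path adj x q ->
  uniq (x :: p) -> uniq (x :: q) -> last x p = last x q -> p = q.
Proof.
move=> acyc; elim: p x q => [|y p IH] x [|z q] //.
- by move=> _ _ _ /andP[xq _] /= e; case/negP: xq; rewrite [x in x \in _]e mem_last.
- by move=> _ _ /andP[xp _] _ /= e; case/negP: xp; rewrite -[x in x \in _]e mem_last.
have [-> | yz] := eqVneq y z.
  move=> /= /andP[_ hp] /andP[_ hq] /andP[_ up] /andP[_ uq] e.
  by congr cons; apply: IH up uq e.
move=> /= /andP[xy hp] /andP[xz hq] /andP[xNp up] /andP[xNq uq] e.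
have hr : path adj z (q ++ rev (belast y p)).
  rewrite cat_path hq /= -e rev_path.
  by rewrite (eq_path (e' := adj)) // => u v; rewrite adj_sym.
have lr : last z (q ++ rev (belast y p)) = y.
  rewrite last_cat -e; case: (p) => //= t p'.
  by rewrite rev_cons last_rcons.
case/shortenP: hr lr => r hr ur sub lr.
exfalso; apply: (acyc [:: x, z & r]).
  case: r lr {hr ur sub} => //= zy; by rewrite zy eqxx in yz.
rewrite /ucycle /= rcons_path xz hr lr adj_sym xy /=.
apply/andP; split=> //; apply/negP; rewrite inE => /predU1P[exz|/sub].
  by move: xNq; rewrite exz mem_head.
rewrite mem_cat mem_rev => /orP[xq|xp].
  by move: xNq; rewrite inE xq orbT.
by case/negP: xNp; exact: mem_belast xp.
Qed.

(** Between the two ends, [P] is a path too, so by uniqueness it is the given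
    one; reversal accounts for the order in which [P] visits the ends. *)
Lemma acyclic_path_infix (G : sgraph) (P : seq G) (x : G) (p : seq G) :
  acyclic_graph G -> sorted adj P -> uniq P -> is_path x p ->
  x \in P -> last x p \in P -> infix (x :: p) P \/ infix (rev (x :: p)) P.
Proof.
move=> acyc.
have fwd (y : G) q s1 s2 : sorted adj (s1 ++ y :: s2) -> uniq (s1 ++ y :: s2) ->
    is_path y q -> last y q \in y :: s2 -> infix (y :: q) (s1 ++ y :: s2).
  move=> sP uP /andP[hq uq] lq.
  case/splitPl: lq sP uP => p1 p2 e.
  rewrite -cat_cons => sP uP; apply/infixP; exists s1, p2.
  congr (_ ++ (_ :: _) ++ _); apply: (@acyclic_path_unique _ y) => //.
  - by have /cat_sorted2[_ /cat_sorted2[]] := sP.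
  - by move: uP; rewrite !cat_uniq => /and3P[_ _ /and3P[]].
move=> sP uP xp xP; case/splitPr: xP sP uP => s1 s2 sP uP.
rewrite mem_cat => /orP[ls1|ls2]; last by left; apply: fwd.
right; case/splitPr: ls1 sP uP => a b; rewrite -catA cat_cons => sP uP.
rewrite lastI rev_rcons; apply: fwd => //; last first.
  rewrite (_ : last _ (rev _) = x) ?inE ?mem_cat ?mem_head ?orbT //.
  by case: (p) => //= t p'; rewrite rev_cons last_rcons.
case/andP: xp => hp up; rewrite /is_path rev_path -rev_rcons -lastI rev_uniq up.
by rewrite (eq_path (e' := adj)) ?hp // => u v; rewrite adj_sym.
Qed.

(** * Spines: one path per component, meeting all its bags *)

(** Consecutive vertices share a bag, and no vertex can skip a bag between two
    others, so a path cannot jump over the [j]-th bag. *)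
Lemma path_meets_bag (G : sgraph) (B : seq {set G}) (x : G) p i j k :
  path_decomposition B -> i <= j <= k -> k < size B ->
  path adj x p -> x \in nth set0 B i -> last x p \in nth set0 B k ->
  has (fun z => z \in nth set0 B j) (x :: p).
Proof.
case=> _ edgeB convB ijk kB; elim: p x i ijk => [|y p IH] x i ijk /=.
  by move=> _ xi xk; rewrite (convB _ _ _ _ ijk).
case/andP=> xy hp xi lk; apply/orP.
have [b bB /andP[xb yb]] := edgeB _ _ xy.
case/(nthP set0): bB => m mB eb; subst b.
have [mj|jm] := leqP m j.
  by right; apply: (IH y m) => //; lia.
by left; apply: (convB x i j m) => //; lia.
Qed.

Definition induced_adj (G : sgraph) (S : {set G}) : rel G :=
  [rel x y | [&& adj x y, x \in S & y \in S]].

(** In each component of the subgraph induced by [S], the spine is a path from a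
    vertex in the leftmost bag to a vertex in the rightmost bag met by the
    component; [path_meets_bag] gives the last property.  [P x] is indexed by
    vertices, as the spine of the component of [x]. *)
Lemma spine_exists (G : sgraph) (B : seq {set G}) (S : {set G}) :
  acyclic_graph G -> path_decomposition B ->
  exists P : G -> seq G,
   [/\ forall x y, connect (induced_adj S) x y -> P x = P y,
       forall x, sorted adj (P x) && uniq (P x),
       forall x z, z \in P x -> connect (induced_adj S) x z &
       forall x b, b \in B -> x \in b -> exists2 z, z \in P x & z \in b].
Proof.
move=> acyc decB; set e := induced_adj S.
have symE : connect_sym e.
  apply: sym_connect_sym => x y.
  by rewrite /e /induced_adj /= adj_sym; do !bool_congr.
suff /fin_all_exists[P HP] : forall x, exists P : seq G,
    [/\ sorted adj P && uniq P, forall z, z \in P -> connect e x z &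
     forall y b, connect e x y -> b \in B -> y \in b ->
       exists2 z, z \in P & z \in b].
  exists (P \o root e); split=> /=.
  - by move=> x y /(rootP symE)->.
  - by move=> x; have [] := HP (root e x).
  - move=> x z; have [_ H _] := HP (root e x).
    by move/H; apply: connect_trans; rewrite connect_root.
  - move=> x b; have [_ _ H] := HP (root e x).
    by apply: H; rewrite symE connect_root.
move=> x.
pose Pr (u : 'I_(size B) * G) := connect e x u.2 && (u.2 \in nth set0 B u.1).
have [b bB xb] : exists2 b, b \in B & x \in b by case: decB.
have [i iB eb] := nthP set0 bB.
have Pr0 : Pr (Ordinal iB, x) by rewrite /Pr /= connect0 eb.
have [[l u] /andP[/= xu lu] minl] :=
  @arg_minnP _ (Ordinal iB, x) Pr (fun u => u.1 : nat) Pr0.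
have [[r v] /andP[/= xv rv] maxr] :=
  @arg_maxnP _ (Ordinal iB, x) Pr (fun u => u.1 : nat) Pr0.
have /connectP[p0 hp0 ep0] : connect e u v.
  by apply: connect_trans xv; rewrite symE.
case/shortenP: hp0 ep0 => p hp up _ ev.
have hpa : path adj u p by apply: sub_path hp => y z /= /and3P[].
exists (u :: p); split.
- by rewrite /= hpa.
- by move=> z /(path_connect hp); apply: connect_trans.
move=> y c xy cB yc; have [j jB ec] := nthP set0 cB; subst c.
have lj : l <= j by apply: (minl (Ordinal jB, y)); rewrite /Pr /= xy.
have jr : j <= r by apply: (maxr (Ordinal jB, y)); rewrite /Pr /= xy.
apply/hasP; apply: (path_meets_bag decB (i := l) (k := r)) => //.
- by rewrite lj jr.
- by rewrite -ev.
Qed.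

(** * Sequences of labels along a path *)

Lemma map_pairmap (T T' T'' : Type) (h : T' -> T'') (f : T -> T -> T') x p :
  map h (pairmap f x p) = pairmap (fun y z => h (f y z)) x p.
Proof. by elim: p x => //= y p IH x; rewrite IH. Qed.

Lemma pairmap_rev (T T' : Type) (f : T -> T -> T') x p :
  (forall y z, f y z = f z y) ->
  pairmap f (last x p) (rev (belast x p)) = rev (pairmap f x p).
Proof.
move=> fC; elim: p x => //= y p IH x.
rewrite !rev_cons -!cats1 pairmap_cat IH /= fC; congr (_ ++ [:: f x _]).
by case: (p) => //= z p'; rewrite rev_cons last_rcons.
Qed.

Lemma eq_pairmap_in (T : eqType) T' (a : pred T) (f g : T -> T -> T') x p :
  (forall y z, a y -> a z -> f y z = g y z) ->
  all a (x :: p) -> pairmap f x p = pairmap g x p.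
Proof.
move=> efg; elim: p x => //= y p IH x /and3P[ax ay ap].
by rewrite efg // IH //= ay.
Qed.

(** Labelling the edge between positions [i] and [i.+1] of [s] with letter [i.+1]
    of [w] (the larger position, which is symmetric in the two ends) makes the
    sub-paths of [s] read off factors of [w]. *)
Lemma pairmap_index_infix (T C : eqType) (c0 : C) (s : seq T) (w : seq C)
    x p :
  uniq s -> infix (x :: p) s -> size s <= size w ->
  infix (pairmap (fun y z => nth c0 w (maxn (index y s) (index z s))) x p) w.
Proof.
move=> us /infixP[s1 [s2 es]] sw; set f := fun _ _ => _.
suff -> : pairmap f x p = take (size p) (drop (size s1).+1 w).
  apply: (@infix_trans _ (drop (size s1).+1 w)).
    exact: infix_take.
  exact: infix_drop.
elim: p x s1 es => [|y p IH] x s1 es /=; first by rewrite take0.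
have ix : index x s = size s1.
  move: us; rewrite es cat_uniq => /and3P[_ /hasPn/(_ x) + _].
  by rewrite index_cat /= eqxx addn0 inE eqxx => /(_ isT)/negPf->.
have es' : s = rcons s1 x ++ (y :: p) ++ s2 by rewrite es cat_rcons.
have iy : index y s = (size s1).+1.
  move: us; rewrite es' cat_uniq => /and3P[_ /hasPn/(_ y) + _].
  by rewrite index_cat /= eqxx addn0 inE eqxx size_rcons => /(_ isT)/negPf->.
have lw : (size s1).+1 < size w.
  by apply: leq_trans sw; rewrite es' !size_cat size_rcons /=; lia.
by rewrite (drop_nth c0 lw) /= (IH _ _ es') size_rcons /f ix iy (maxn_idPr _).
Qed.

Definition crossings (T : Type) (Q : pred T) x p : nat :=
  count id (pairmap (fun y z => Q y (+) Q z) x p).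

Lemma no_crossing (T : Type) (Q : pred T) x p :
  crossings Q x p = 0 -> all (fun z => Q z == Q x) p.
Proof.
rewrite /crossings; elim: p x => //= y p IH x.
case: eqVneq => [exy|]; last first.
  by case: (Q x) (Q y) => -[].
by move/eqP; rewrite addn_eq0 => /andP[_ /eqP/IH]; rewrite exy.
Qed.

(** The convexity hypothesis says that a walk that leaves [Q] does not come back,
    so it enters and leaves [Q] at most once. *)
Lemma crossings_le2 (T : eqType) (Q : pred T) x p :
  (forall y s, infix (y :: s) (x :: p) -> Q y -> Q (last y s) -> all Q s) ->
  crossings Q x p <= 2.
Proof.
have out y s : ~~ Q y -> ~~ has Q s -> crossings Q y s = 0.
  rewrite /crossings; elim: s y => //= z s IH y /negPf->.
  by rewrite negb_or => /andP[zQ] /(IH _ zQ)->; rewrite (negPf zQ).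
have inside y s : Q y ->
    (forall s', prefix s' s -> Q (last y s') -> all Q s') -> crossings Q y s <= 1.
  rewrite /crossings; elim: s y => //= z s IH y Qy conv; rewrite Qy.
  have [Qz | nQz] /= := boolP (Q z).
    apply: (IH z Qz) => s' pre Qs'; have := conv (z :: s').
    by rewrite /= eqxx => /(_ pre Qs') /andP[].
  rewrite -/(crossings Q z s) out //; apply/hasPn => u us; apply/negP => Qu.
  case/splitPr: us conv => s1 s2 conv; have := conv (z :: rcons s1 u).
  rewrite -cat_rcons /= eqxx prefix_prefix /= last_rcons => /(_ isT Qu).
  by rewrite (negPf nQz).
have pre_inf y s s' : prefix s' s -> infix (y :: s') (y :: s).
  by move=> pre; apply: prefixW; rewrite /= eqxx.
elim: p x => // y p IH x conv; have [Qx | nQx] := boolP (Q x).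
  by apply: leq_trans (inside _ _ Qx _) _ => // s' /pre_inf/conv; apply.
have conv' z s : infix (z :: s) (y :: p) -> Q z -> Q (last z s) -> all Q s.
  by move=> inf; apply: conv; apply: infix_trans inf _; exact: infix_cons.
rewrite /crossings /= (negPf nQx) -/(crossings Q y p).
case: (boolP (Q y)) => Qy /=; last exact: IH.
rewrite add1n ltnS; apply: inside => // s' /pre_inf/conv'; exact.
Qed.

(** * Colouring induced subgraphs *)

Lemma path_induced (G : sgraph) (S : {set G}) x p :
  path adj x p -> all (mem S) (x :: p) -> path (induced_adj S) x p.
Proof.
elim: p x => //= y p IH x /andP[xy hp] /and3P[xS yS pS].
by rewrite /induced_adj /= xy xS yS IH //= yS.
Qed.

Definition set_colours (G : sgraph) (g : {set G} -> nat) x p : seq nat :=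
  pairmap (fun y z => g [set y; z]) x p.

(** By uniqueness of paths, a path with both ends on the spine runs along the
    spine, in one direction or the other, so its colours form a factor of [w] or
    the reverse of one. *)
Lemma spine_colours (G : sgraph) (P : seq G) (w : seq nat)
    (g : {set G} -> nat) x p :
  acyclic_graph G -> sorted adj P -> uniq P -> size P <= size w ->
  abelian_cube_free w ->
  (forall y z, y \in P -> z \in P ->
     g [set y; z] = nth 0 w (maxn (index y P) (index z P))) ->
  is_path x p -> x \in P -> last x p \in P ->
  all (mem P) (x :: p) /\ ~ anagram3 (set_colours g x p).
Proof.
move=> acyc sP uP sw free gE xp xP lP.
have inf := acyclic_path_infix acyc sP uP xp xP lP.
have pP : all (mem P) (x :: p).
  by apply/allP => z zp; case: inf => /mem_infix; apply; rewrite ?mem_rev.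
split=> //.
pose f y z := nth 0 w (maxn (index y P) (index z P)).
have -> : set_colours g x p = pairmap f x p.
  by apply: eq_pairmap_in pP => *; apply: gE.
case: inf => inf; first exact/free/pairmap_index_infix.
move/anagram3_rev; rewrite -pairmap_rev; last by move=> y z; rewrite /f maxnC.
move: inf; rewrite lastI rev_rcons => inf; exact/free/pairmap_index_infix.
Qed.

Definition good_colouring (G : sgraph) (S : {set G}) n
    (g : {set G} -> nat) : Prop :=
  (forall x y, x \in S -> y \in S -> adj x y -> g [set x; y] < n) /\
  (forall x p, is_path x p -> all (mem S) (x :: p) ->
     ~ anagram3 (set_colours g x p)).

(** The four new colours are three for the edges inside [Q], which carry a ternary
    word without abelian cubes along each spine, and one for the edges between
    [Q] and its complement.  The latter colour occurs at most twice on a path,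
    while a 3-anagram would contain it a multiple of three times: so a path that
    is a 3-anagram stays outside [Q] or has both ends on a spine. *)
Lemma extend_colouring (G : sgraph) (S Q : {set G}) (P : G -> seq G) n g' :
  acyclic_graph G -> Q \subset S ->
  (forall x y, connect (induced_adj S) x y -> P x = P y) ->
  (forall x, sorted adj (P x) && uniq (P x)) ->
  (forall x z, z \in P x -> connect (induced_adj S) x z) ->
  (forall x z, x \in S -> z \in P x -> z \in Q) ->
  (forall x, x \in Q -> x \in P x) ->
  good_colouring (S :\: Q) n g' -> exists g, good_colouring S (n + 4) g.
Proof.
move=> acyc QS constP pathP connP PQ QP [bound' free'].
have [w sw [w3 free]] := ternary_cube_free_word #|G|.
pose pos x := index x (P x).
pose g (A : {set G}) := if A \subset Q then n + nth 0 w (\max_(x in A) pos x)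
            else if [disjoint A & Q] then g' A else n + 3.
have gin y z : y \in Q -> z \in Q ->
    g [set y; z] = n + nth 0 w (maxn (pos y) (pos z)).
  move=> yQ zQ; rewrite /g subUset !sub1set yQ zQ /=.
  have [->|yz] := eqVneq y z; first by rewrite setUid big_set1 maxnn.
  by rewrite big_setU1 ?inE // big_set1.
have gout y z : y \notin Q -> z \notin Q -> g [set y; z] = g' [set y; z].
  move=> yQ zQ; rewrite /g subUset !sub1set (negPf yQ) /=.
  by rewrite disjoints_subset subUset !sub1set !inE yQ zQ.
have gcross y z : (y \in Q) (+) (z \in Q) -> g [set y; z] = n + 3.
  move=> c; rewrite /g subUset !sub1set disjoints_subset subUset !sub1set !inE.
  by case: (y \in Q) (z \in Q) c => [] [].
have w_lt i : nth 0 w i < 3.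
  have [iw|wi] := ltnP i (size w); last by rewrite nth_default.
  exact: (allP w3) (mem_nth 0 iw).
exists g; split=> [x y xS yS xy|x p xp pS].
  case: (boolP (x \in Q)) => xQ; case: (boolP (y \in Q)) => yQ.
  - by rewrite gin // ltn_add2l ltnS ltnW.
  - by rewrite gcross ?xQ ?(negPf yQ) // ltn_add2l.
  - by rewrite gcross ?yQ ?(negPf xQ) // ltn_add2l.
  by rewrite gout // ltn_addr // bound' // inE ?xQ ?yQ.
have spine y s : is_path y s -> all (mem S) (y :: s) ->
    y \in Q -> last y s \in Q ->
    all (mem Q) (y :: s) /\ ~ anagram3 (set_colours g y s).
  move=> ys sS yQ lQ.
  have /andP[hys _] := ys.
  have same z : z \in P y -> P z = P y by move/connP/constP.
  have /andP[sP uP] := pathP y.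
  have yP : y \in P y by exact: QP.
  have lP : last y s \in P y.
    rewrite (constP _ (last y s)) ?QP //.
    by apply/connectP; exists s => //; exact: path_induced.
  have [] := @spine_colours _ (P y) w (fun A => g A - n) y s acyc sP uP _ free _
    ys yP lP.
  - by apply: leq_trans (ltnW sw); rewrite -(card_uniqP uP) max_card.
  - move=> a b aP bP; rewrite gin ?(PQ y) ?(subsetP QS) // addKn.
    by rewrite /pos !same.
  move=> sP' nan; split.
    by apply: sub_all sP' => z; apply: PQ; exact: (subsetP QS).
  move=> /(anagram3_map (fun c => c - n)); by rewrite /set_colours map_pairmap.
move=> an.
have /andP[hp up] := xp.
have cr2 : crossings (mem Q) x p <= 2.
  apply: crossings_le2 => y s inf yQ lQ.
  have ys : is_path y s.
    case/infixP: inf => s1 [s2 e]; move: hp up.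
    rewrite /is_path -/(sorted adj (x :: p)) e.
    move=> /cat_sorted2[_ /cat_sorted2[hs _]]; rewrite !cat_uniq.
    by move=> /and3P[_ _ /and3P[us _ _]]; apply/andP.
  have sS : all (mem S) (y :: s) by apply/allP => z /(mem_infix inf)/(allP pS).
  by have [/andP[]] := spine y s ys sS yQ lQ.
have crE : crossings (mem Q) x p = count (pred1 (n + 3)) (set_colours g x p).
  rewrite /crossings /set_colours {an cr2 xp}.
  elim: p x hp pS {up} => //= y p IH x.
  case/andP=> xy hp /and3P[xS yS pS]; rewrite IH //= ?yS //; congr (_ + _).
  case: (boolP (x \in Q)) => xQ; case: (boolP (y \in Q)) => yQ /=.
  - by rewrite gin // eqn_add2l ltn_eqF.
  - by rewrite gcross ?xQ ?(negPf yQ) // eqxx.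
  - by rewrite gcross ?yQ ?(negPf xQ) // eqxx.
  by rewrite gout // ltn_eqF // ltn_addr // bound' // inE ?xQ ?yQ.
have {cr2 crE} cr0 : crossings (mem Q) x p = 0.
  move: cr2 (anagram3_count (pred1 (n + 3)) an); rewrite crE.
  by case: count => [|[|[|]]].
have allE := no_crossing cr0.
have [xQ|xQ] := boolP (x \in Q).
  have lQ : last x p \in Q.
    have := mem_last x p; rewrite inE => /predU1P[->//|/(allP allE)/=].
    by rewrite xQ => /eqP.
  by have [_] := spine x p xp pS xQ lQ; apply.
have outp : all [predC Q] (x :: p).
  by rewrite /= xQ; apply/allP => z /(allP allE)/=; rewrite (negPf xQ) => /eqP->.
apply: (free' x p xp).
  apply/allP => z zp; rewrite /= in_setD; apply/andP.
  by split; [exact: (allP outp _ zp) | exact: (allP pS _ zp)].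
suff <- : set_colours g x p = set_colours g' x p by [].
by apply: eq_pairmap_in outp => y z; exact: gout.
Qed.

(** Removing all spines removes a vertex of every bag that meets [S], so the
    induction on the bag size peels off one layer of spines, and pays four
    colours for it.  Bags are those of the whole graph, cut down to [S]. *)
Lemma colouring_exists (G : sgraph) (B : seq {set G}) (S : {set G}) k :
  acyclic_graph G -> path_decomposition B ->
  (forall b, b \in B -> #|b :&: S| <= k.+1) ->
  exists g, good_colouring S (4 * k) g.
Proof.
move=> acyc decB; elim: k S => [|k IH] S small.
  have noedge x y : x \in S -> y \in S -> adj x y -> False.
    move=> xS yS xy; have [_ /(_ x y xy)[b bB /andP[xb yb]] _] := decB.
    have /card_le1_eqP/(_ x y) := small b bB.
    rewrite !inE xb yb xS yS => /(_ isT isT) exy.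
    by rewrite exy adj_irrefl in xy.
  exists (fun=> 0); split=> [x y xS yS /noedge|x [|y p]]; first by case.
    by move=> _ _; exact: anagram3_nil.
  by move=> /andP[/= /andP[xy _] _] /and3P[xS yS _]; case: (noedge x y).
have [P [constP pathP connP meetP]] := spine_exists S acyc decB.
pose Q := [set x in S | x \in P x].
have closedS x z : x \in S -> connect (induced_adj S) x z -> z \in S.
  move=> xS /connectP[p]; elim: p x xS => [|y p IHp] x xS /=; first by move=> _ ->.
  by case/andP=> /and3P[_ _ yS]; exact: IHp.
have PQ x z : x \in S -> z \in P x -> z \in Q.
  move=> xS zP; have xz := connP _ _ zP.
  by rewrite inE (closedS x) //= -(constP x z).
have [b bB|g' good'] := IH (S :\: Q).
  have [bS0|[x]] := set_0Vmem (b :&: S).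
    by rewrite setIDA bS0 set0D cards0.
  rewrite inE => /andP[xb xS]; rewrite -ltnS; apply: leq_trans (small b bB).
  have [z zP zb] := meetP _ _ bB xb.
  have zQ := PQ _ _ xS zP; apply: proper_card; apply/properP; split.
    by apply/setIS/subsetDl.
  exists z; last by rewrite in_setI in_setD zQ andbF.
  by rewrite inE zb; move: zQ; rewrite inE => /andP[].
rewrite mulnS addnC; apply: (extend_colouring (P := P) (Q := Q)) good' => //.
- by apply/subsetP => x; rewrite inE => /andP[].
- by move=> x; rewrite inE => /andP[].
Qed.

Theorem theorem8 (T : sgraph) (hT : is_tree T) :
  anagram3_index T <= 4 * pathwidth T.
Proof.
have acyc : acyclic_graph T by case: hT.
rewrite /pathwidth; case: ex_minnP => k /boolp.asboolP[B decB wB] _.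
have [|g [bound free]] := @colouring_exists T B setT k acyc decB.
  move=> b bB; rewrite setIT -wB /width.
  apply: leq_trans (leqSpred _).
  exact: (@leq_bigmax_seq _ _ predT (fun b : {set T} => #|b|)).
rewrite /anagram3_index; case: ex_minnP => m _; apply; apply/boolp.asboolP.
have bound_e (a : edge T) : g (val a) < 4 * k.
  case: a => A /= ; rewrite inE => /existsP[x /existsP[y /andP[xy /eqP->]]].
  by apply: bound; rewrite ?inE.
exists (fun a => Ordinal (bound_e a)) => x p xp /(anagram3_map val).
rewrite -map_comp.
rewrite (_ : map _ _ = set_colours g x p).
  by apply: free xp _; apply/allP => z _; rewrite inE.
have /andP[hp _] := xp.
by rewrite (_ : _ \o _ = g \o val) // map_comp val_path_edges // map_pairmap.
Qed.
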